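(* Let $F(x,t)$ be a family of polynomials of the ''second kind'' with coefficients in $A$, that is, $$F(x,t)=x^2A_{n-2}(x)+2xB_{n-1}(x)t+C_n(x)t^2+O(t^3),$$ where $A_{n-2},B_{n-1},C_n\in A[x]$ (subscripts denoting degrees), $A_{n-2}(0)\big(B_{n-1}^2(0)-A_{n-2}(0)C_n(0)\big)\ne0$ and $A_{n-2}(x)$ is square-free. Then $$\operatorname{Ver}(F)=4\big(B_{n-1}^2(0)-A_{n-2}(0)C_n(0)\big)A_{n-2}^2(0).$$
   Context: $k$ is an algebraically closed field of characteristic zero, $A$ is a $k$-algebra and integral domain, $K=\operatorname{Frac}(A)$ and $\overline K$ is an algebraic closure of $K$. Family of polynomials of degree $n$ with coefficients in $A$: $F(x,t)=\sum_{i\ge0}F_i(x)t^i$ with $F_i\in A[x]$, $\deg F_0=n$, $\deg F_i\le n$ for $i>0$. View $F$ as a polynomial in $x$ of degree $n$ over $A[[t]]$ with leading coefficient $u(t)$. The $t$-roots of $F$ are its $n$ roots in $\bigcup_N\overline K((t^{1/N}))$; they lie in $\bigcup_N\overline K[[t^{1/N}]]$, and their constant terms are the roots of $F_0$. For a nonzero Puiseux series $g$ in $t$, $g_0$ is the coefficient of its lowest power of $t$. For $h=a_p\prod_{i=1}^p(x-\alpha_i)$ and $g$ of degree $m$, $\operatorname{Res}(h,g)=a_p^m\prod_ig(\alpha_i)$. Vertex: for $F_0=\prod_\nu f_\nu^{n_\nu}$ with $f_\nu$ coprime having roots $a_{\nu\ell}$, $\operatorname{Ver}(F):=\prod_{\nu,\ell}\Delta(F,f_\nu)(a_{\nu\ell},t)_0\prod_{\nu<\nu'}\operatorname{Res}(f_\nu,f_{\nu'})^{2(n_\nu+n_{\nu'}-n_\nu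 n_{\nu'})}$, where $\Delta(F,f_\nu)$ is the generalized formal discriminant: writing $F=Q\prod_{i=1}^{n_\nu}(f_\nu-s_i'(x,t))$ with $Q$ collecting $u(t)$ and the factors $(x-s)$ for the $t$-roots $s$ with $f_\nu(s(0))\neq0$, $\Delta(F,f_\nu)(x,t)$ is the discriminant in $w$ of $Q\prod_i(w-s_i')$, namely $Q^{2n_\nu-2}\prod_{i<j}(s_i'-s_j')^2$. Here the factorization used is $f_1=x$, $n_1=2$ and $f_2=A_{n-2}$, $n_2=1$. Since $n_2=1$, $\Delta(F,f_2)=1$. If $s_1,s_2$ are the two $t$-roots with constant term $0$ and $s_3,\dots,s_n$ the others, then $\Delta(F,x)(0,t)=\big[u(t)\prod_{j\ge3}(-s_j)\big]^{2}(s_1-s_2)^2$. Hence $\operatorname{Ver}(F)=\Delta(F,x)(0,t)_0\cdot\operatorname{Res}(x,A_{n-2})^{2(2+1-2)}$. *)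

(* Defs.v *)
From HB Require Import structures.
From mathcomp Require Import all_boot all_order all_algebra boolp.

Set Implicit Arguments.
Unset Strict Implicit.
Unset Printing Implicit Defensive.

Import GRing.Theory.
Local Open Scope ring_scope.

Record fps (R : Type) := Fps { fcoef : nat -> R }.

HB.instance Definition _ (R : Type) := gen_eqMixin (fps R).
HB.instance Definition _ (R : Type) := gen_choiceMixin (fps R).

Lemma fpsP (R : Type) (f g : fps R) : fcoef f =1 fcoef g -> f = g.
Proof. by case: f g => [f] [g] /= /funext ->. Qed.

Section FpsRing.
Variable R : comNzRingType.
Implicit Types f g h : fps R.

Definition fps0 : fps R := Fps (fun=> 0).
Definition fps_opp f := Fps (fun m => - fcoef f m).
Definition fps_add f g := Fps (fun m => fcoef f m + fcoef g m).
Definition fpsC (c : R) := Fps (fun m => if m == 0%N then c else 0).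
Definition fps_mul f g :=
  Fps (fun m => \sum_(i < m.+1) fcoef f i * fcoef g (m - i)).

Lemma fps_addA : associative fps_add.
Proof. by move=> f g h; apply: fpsP => m /=; rewrite addrA. Qed.
Lemma fps_addC : commutative fps_add.
Proof. by move=> f g; apply: fpsP => m /=; rewrite addrC. Qed.
Lemma fps_add0 : left_id fps0 fps_add.
Proof. by move=> f; apply: fpsP => m /=; rewrite add0r. Qed.
Lemma fps_addN : left_inverse fps0 fps_opp fps_add.
Proof. by move=> f; apply: fpsP => m /=; rewrite addNr. Qed.

HB.instance Definition _ :=
  GRing.isZmodule.Build (fps R) fps_addA fps_addC fps_add0 fps_addN.

Let trunc m f : {poly R} := \poly_(i < m) fcoef f i.

Let coef_trunc m f i : (i < m)%N -> (trunc m f)`_i = fcoef f i.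
Proof. by move=> lt_im; rewrite coef_poly lt_im. Qed.

Let coef_mul_trunc m f g i :
  (i < m)%N -> (trunc m f * trunc m g)`_i = fcoef (fps_mul f g) i.
Proof.
move=> lt_im; rewrite coefM; apply: eq_bigr => j _.
rewrite !coef_trunc //; first exact: leq_ltn_trans (leq_subr _ _) lt_im.
by apply: leq_trans lt_im; exact: ltn_ord.
Qed.

Lemma fps_mulC : commutative fps_mul.
Proof.
by move=> f g; apply: fpsP => m; rewrite -!(@coef_mul_trunc m.+1) // mulrC.
Qed.

Lemma fps_mulA : associative fps_mul.
Proof.
move=> f g h; apply: fpsP => m /=.
transitivity ((trunc m.+1 f * (trunc m.+1 g * trunc m.+1 h))`_m).
  rewrite coefM; apply: eq_bigr => i _.
  by rewrite coef_trunc ?ltn_ord // coef_mul_trunc // ltnS leq_subr.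
rewrite mulrA coefM; apply: eq_bigr => i _.
by rewrite coef_mul_trunc ?ltn_ord // coef_trunc // ltnS leq_subr.
Qed.

Lemma fps_mul1 : left_id (fpsC 1) fps_mul.
Proof.
move=> f; apply: fpsP => m /=; rewrite big_ord_recl /= mul1r subn0.
by rewrite big1 ?addr0 // => i _; rewrite mul0r.
Qed.

Lemma fps_mulDl : left_distributive fps_mul fps_add.
Proof.
move=> f g h; apply: fpsP => m /=; rewrite -big_split.
by apply: eq_bigr => i _; rewrite mulrDl.
Qed.

Lemma fps_1neq0 : fpsC 1 != 0.
Proof.
apply/eqP => /(congr1 (fun f : fps R => fcoef f 0)) /= /eqP.
by rewrite oner_eq0.
Qed.

HB.instance Definition _ :=
  GRing.Zmodule_isComNzRing.Build (fps R)
    fps_mulA fps_mulC fps_mul1 fps_mulDl fps_1neq0.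

Fact fpsC_zmod_morphism : zmod_morphism fpsC.
Proof. by move=> a b; apply: fpsP => -[|m] //=; rewrite subr0. Qed.

Fact fpsC_monoid_morphism : monoid_morphism fpsC.
Proof.
split=> // a b; apply: fpsP => m /=; rewrite big_ord_recl /= subn0.
rewrite big1 ?addr0 => [|i _]; last by rewrite mul0r.
by case: m => //= m; rewrite mulr0.
Qed.

HB.instance Definition _ :=
  GRing.isZmodMorphism.Build R (fps R) fpsC fpsC_zmod_morphism.
HB.instance Definition _ :=
  GRing.isMonoidMorphism.Build R (fps R) fpsC fpsC_monoid_morphism.

(* The coefficient g_0 of the lowest power occurring in g (0 if g = 0). *)
Definition lowcoef (g : fps R) : R :=
  if pselect (exists m, fcoef g m != 0) is left g_neq0
  then fcoef g (ex_minn g_neq0) else 0.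

End FpsRing.

Definition square_free (K : fieldType) (p : {poly K}) : Prop :=
  forall q : {poly K}, (1 < size q)%N -> ~~ (q ^+ 2 %| p).

(* A family F(x,t) = \sum_i F_i(x) t^i is represented by i |-> F_i. *)
Definition is_family (R : nzRingType) (n : nat) (F : nat -> {poly R}) : Prop :=
  size (F 0%N) = n.+1 /\ forall i, (size (F i) <= n.+1)%N.

Definition second_kind (R : comNzRingType) (n : nat) (F : nat -> {poly R})
    (A B C : {poly R}) : Prop :=
  [/\ size A = n.-1, (size B <= n)%N & (size C <= n.+1)%N] /\
  [/\ F 0%N = 'X^2 * A, F 1%N = 2%:R *: ('X * B) & F 2%N = C].

Section Vertex.
Variable L : closedFieldType.

(* The roots of p, listed with multiplicity. *)
Definition roots (p : {poly L}) : seq L := sval (closed_field_poly_normal p).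

Definition Res (h g : {poly L}) : L :=
  lead_coef h ^+ (size g).-1 * \prod_(a <- roots h) g.[a].

Variables (n : nat) (F : nat -> {poly L}).

(* L[[t^(1/N)]] is represented as fps L in the variable tau = t^(1/N); this is
   F(x, tau^N) as a polynomial in x. *)
Definition ramified (N : nat) : {poly fps L} :=
  \poly_(j < n.+1)
    Fps (fun m => if (N %| m)%N then (F (m %/ N)%N)`_j else 0).

(* As L[[tau]] is a domain, a full splitting over L[[tau]] exhibits all the
   roots lying in any L((t^(1/N'))). *)
Definition t_roots (N : nat) (s : seq (fps L)) : Prop :=
  [/\ (0 < N)%N, size s = n &
      ramified N = lead_coef (ramified N) *: \prod_(z <- s) ('X - z%:P)].

(* For monic f this is u(t) times the product of the x - s with f(s(0)) <> 0;
   in general u(t) has to be divided by lead_coef f ^+ e so that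
   F = Q \prod_(i < e) (f - s'_i) holds with s'_i of degree < deg f. *)
Definition Qpart (N : nat) (s : seq (fps L)) (f : {poly L}) (e : nat) :
    {poly fps L} :=
  (fpsC (lead_coef f ^- e) * lead_coef (ramified N)) *:
    \prod_(z <- s | f.[fcoef z 0] != 0) ('X - z%:P).

(* The constraints that s'_i has x-degree < deg f and vanishes at t = 0 make
   the s'_i the t-roots with constant term 0 when f = x. *)
Definition f_roots (N : nat) (s : seq (fps L)) (f : {poly L}) (e : nat)
    (s' : seq {poly fps L}) : Prop :=
  [/\ size s' = e,
      forall r, r \in s' ->
        (size r < size f)%N /\ (forall j, fcoef r`_j 0 = 0) &
      ramified N =
        Qpart N s f e * \prod_(r <- s') (map_poly (@fpsC L) f - r)].

(* The discriminant in w of Q \prod_(i < e) (w - s'_i). *)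
Definition Delta (Q : {poly fps L}) (e : nat) (s' : seq {poly fps L}) :
    {poly fps L} :=
  Q ^+ (2 * e - 2) *
  \prod_(i < e) \prod_(j < e | (i < j)%N) (s'`_i - s'`_j) ^+ 2.

(* F_0 = \prod_nu f_nu ^ n_nu, given by the pairs (f_nu, n_nu). *)
Definition is_factorization (m : nat) (fs : m.-tuple ({poly L} * nat)) : Prop :=
  [/\ F 0%N = \prod_(v < m) (tnth fs v).1 ^+ (tnth fs v).2,
      forall v, (0 < (tnth fs v).2)%N &
      forall v w, v != w -> coprimep (tnth fs v).1 (tnth fs w).1].

(* Ver(F), computed from the factorization fs of F_0, is y. The t-roots are
   determined only up to order and choice of N, and the s'_i up to order, so
   this is a relation: it holds if some admissible choice yields y. *)
Definition is_Ver (m : nat) (fs : m.-tuple ({poly L} * nat)) (y : L) : Prop :=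
  is_factorization fs /\
  exists (N : nat) (s : seq (fps L)) (s' : 'I_m -> seq {poly fps L}),
    [/\ t_roots N s,
        forall v, f_roots N s (tnth fs v).1 (tnth fs v).2 (s' v) &
        y = (\prod_(v < m)
               let: (f, e) := tnth fs v in
               \prod_(a <- roots f)
                  lowcoef (Delta (Qpart N s f e) e (s' v)).[fpsC a]) *
            (\prod_(v < m) \prod_(w < m | (v < w)%N)
               let: (f, e) := tnth fs v in let: (f', e') := tnth fs w in
               Res f f' ^ (2 * (e%:Z + e'%:Z - e%:Z * e'%:Z)))].

End Vertex.

(* Main.v *)
(* Write F over L[[tau]], t = tau^N, as P = Q (x - a)(x - b), where a, b are the
   two t-roots with constant term 0. Since ab = O(t^2) and a + b = O(t), the
   leading term of Q(0)^2 (a - b)^2 is that of the discriminant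
   P_1^2 - 4 P_0 P_2 of the quadratic part of P, namely 4 (B(0)^2 - A(0) C(0)) t^2. This shows
   that every admissible choice of t-roots gives the stated value.
   A choice exists with N = 1: the n - 2 simple nonzero roots of F_0 lift to
   L[[t]] by Hensel's lemma, and after the substitution x = t w and division by
   t^2, F reduces to A(0) w^2 + 2 B(0) w + C(0), whose two simple roots also
   lift. *)
Require Import Defs.
From HB Require Import structures.
From mathcomp Require Import all_boot all_order all_algebra.
From mathcomp Require Import boolp separable.
From mathcomp Require Import ring.
Set Implicit Arguments.
Unset Strict Implicit.
Unset Printing Implicit Defensive.
Import GRing.Theory.
Local Open Scope ring_scope.

(** * Orders of vanishing in power series, and reduction modulo tau *)

Section Order.
Variable R : comNzRingType.
Implicit Types f g : fps R.

Lemma fcoefD f g m : fcoef (f + g) m = fcoef f m + fcoef g m.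
Proof. by []. Qed.

Lemma fcoefB f g m : fcoef (f - g) m = fcoef f m - fcoef g m.
Proof. by []. Qed.

(** Divisibility by tau^m, that is, valuation at least m. A lower bound, unlike an exact valuation,
    needs no special case for the zero series. *)
Definition ordge (m : nat) f : Prop := forall i, (i < m)%N -> fcoef f i = 0.

Lemma ordgeW m l f : (l <= m)%N -> ordge m f -> ordge l f.
Proof. by move=> le_lm f_m i lt_il; apply: f_m; apply: leq_trans le_lm. Qed.

Lemma ordge0 f : ordge 0 f.
Proof. by []. Qed.

Lemma ordgeD m f g : ordge m f -> ordge m g -> ordge m (f + g).
Proof. by move=> f_m g_m i lt_im /=; rewrite f_m ?g_m ?addr0. Qed.

Lemma ordgeN m f : ordge m f -> ordge m (- f).
Proof. by move=> f_m i lt_im /=; rewrite f_m ?oppr0. Qed.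

Lemma ordgeB m f g : ordge m f -> ordge m g -> ordge m (f - g).
Proof. by move=> f_m g_m; apply: ordgeD => //; apply: ordgeN. Qed.

Lemma ordgeM m l f g : ordge m f -> ordge l g -> ordge (m + l) (f * g).
Proof.
move=> f_m g_l i lt_iml /=; apply: big1 => h _.
have [lt_hm|le_mh] := ltnP h m; first by rewrite f_m ?mul0r.
rewrite g_l ?mulr0 // ltn_subLR; last by rewrite -ltnS.
by apply: leq_trans lt_iml _; rewrite leq_add2r.
Qed.

Lemma ordgeMr m f g : ordge m f -> ordge m (f * g).
Proof. by move=> f_m; rewrite -[m]addn0; apply: ordgeM. Qed.

Lemma ordgeMl m f g : ordge m g -> ordge m (f * g).
Proof. by move=> g_m; rewrite mulrC; apply: ordgeMr. Qed.

(** Every other term of the convolution has an index below m on the left or below l on the right. *)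
Lemma fcoefM_low m l f g : ordge m f -> ordge l g ->
  fcoef (f * g) (m + l) = fcoef f m * fcoef g l.
Proof.
move=> f_m g_l /=.
have lt_m : (m < (m + l).+1)%N by rewrite ltnS leq_addr.
rewrite (bigD1 (Ordinal lt_m)) //= addKn big1 ?addr0 // => h neq_hm.
have {}neq_hm : (h : nat) != m by rewrite -[m]/(val (Ordinal lt_m)).
have [lt_hm|le_mh] := ltnP h m; first by rewrite f_m ?mul0r.
rewrite g_l ?mulr0 // ltn_subLR; last by rewrite -ltnS.
by rewrite ltn_add2r ltn_neqAle eq_sym neq_hm.
Qed.

Lemma lowcoefE m f : ordge m f -> fcoef f m != 0 -> lowcoef f = fcoef f m.
Proof.
move=> f_m fm_neq0; rewrite /lowcoef.
case: pselect => [f_neq0|[]]; last by exists m.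
case: ex_minnP => i fi_neq0 /(_ _ fm_neq0) le_im.
have [lt_im|le_mi] := ltnP i m; first by rewrite f_m ?eqxx in fi_neq0.
by congr (fcoef f _); apply/eqP; rewrite eqn_leq le_im.
Qed.

Definition fpsXn (m : nat) : fps R := Fps (fun i => (i == m)%:R).

Lemma ordge_Xn m : ordge m (fpsXn m).
Proof. by move=> i lt_im /=; rewrite ltn_eqF. Qed.

Lemma fcoef_XnM m f i :
  fcoef (fpsXn m * f) i = if (m <= i)%N then fcoef f (i - m) else 0.
Proof.
case: leqP => [le_mi|lt_im]; last exact: (ordgeMr _ (@ordge_Xn m)).
have lt_m : (m < i.+1)%N by rewrite ltnS.
rewrite /= (bigD1 (Ordinal lt_m)) //= eqxx mul1r big1 ?addr0 // => h neq_hm.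
by rewrite (_ : _ == m = false) ?mul0r //; apply: negbTE.
Qed.

Lemma fpsXnD m l : fpsXn m * fpsXn l = fpsXn (m + l).
Proof.
apply: fpsP => i; rewrite fcoef_XnM /=; case: leqP => [le_mi|lt_im].
  by rewrite -(eqn_add2l m) subnKC.
by rewrite ltn_eqF // (leq_trans lt_im) ?leq_addr.
Qed.

Lemma fpsXnX m : fpsXn 1 ^+ m = fpsXn m.
Proof.
by elim: m => [|m IHm]; [apply: fpsP => -[|i] | rewrite exprS IHm fpsXnD].
Qed.

Definition fps_const f : R := fcoef f 0.

Fact fps_const_zmod_morphism : zmod_morphism fps_const.
Proof. by []. Qed.

Fact fps_const_monoid_morphism : monoid_morphism fps_const.
Proof. by split=> // f g; rewrite /fps_const /= big_ord1. Qed.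

HB.instance Definition _ :=
  GRing.isZmodMorphism.Build (fps R) R fps_const fps_const_zmod_morphism.
HB.instance Definition _ :=
  GRing.isMonoidMorphism.Build (fps R) R fps_const fps_const_monoid_morphism.

Lemma fps_const_XnM m f : fps_const (fpsXn m.+1 * f) = 0.
Proof. by rewrite /fps_const fcoef_XnM. Qed.

Lemma fps_const_horner (P : {poly fps R}) z :
  fps_const P.[z] = (map_poly fps_const P).[fps_const z].
Proof. by rewrite horner_map. Qed.

End Order.

(** * First- and second-order expansion of polynomials over a commutative ring *)

Section Taylor.
Variable R : comNzRingType.
Implicit Types (p : {poly R}) (x y h : R).

Lemma poly_XsubC_eq p y : exists q, p = (p.[y])%:P + ('X - y%:P) * q.
Proof.
have /factor_theorem[q def_q] : root (p - (p.[y])%:P) y.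
  by rewrite /root hornerD hornerN hornerC subrr.
by exists q; rewrite mulrC -def_q addrC subrK.
Qed.

Lemma horner_subr p x y : exists k, p.[x] - p.[y] = (x - y) * k.
Proof.
have [q def_p] := poly_XsubC_eq p y; exists q.[x].
by rewrite {1}def_p !hornerE addrAC subrr add0r.
Qed.

(** Dividing twice by X - y gives the expansion without dividing by factorials. *)
Lemma horner_taylor2 p y h :
  exists k, p.[y + h] = p.[y] + p^`().[y] * h + h ^+ 2 * k.
Proof.
have [q def_p] := poly_XsubC_eq p y.
have [r def_q] := poly_XsubC_eq q y; exists r.[y + h].
have -> : p^`().[y] = q.[y].
  by rewrite def_p derivD derivM derivXsubC derivC !hornerE; ring.
by rewrite {1}def_p {1}def_q !hornerE; ring.
Qed.

End Taylor.

(** * Power series over a field: cancellation, splitting and Hensel's lemma *)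

Section FpsField.
Variable K : fieldType.
Implicit Types (f g z : fps K) (P : {poly fps K}).

Lemma fps_ordP f : f != 0 -> exists2 m, ordge m f & fcoef f m != 0.
Proof.
move=> f_neq0; have [ex_m|no_m] := pselect (exists m, fcoef f m != 0).
  case: (ex_minnP ex_m) => m fm_neq0 min_m; exists m => // i lt_im.
  by apply/eqP; apply: contraLR lt_im => /min_m; rewrite -leqNgt.
case/eqP: f_neq0; apply: fpsP => m; apply/eqP; apply: contrapT => /negP fm.
by apply: no_m; exists m.
Qed.

Lemma fps_mulf_eq0 f g : f != 0 -> f * g = 0 -> g = 0.
Proof.
move=> /fps_ordP[m f_m fm_neq0] fg0; apply/eqP; apply: contraT.
move=> /fps_ordP[l g_l gl_neq0].
have := fcoefM_low f_m g_l; rewrite fg0 => /esym/eqP.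
by rewrite mulf_eq0 (negbTE fm_neq0) (negbTE gl_neq0).
Qed.

(** Multiplying by the unit f preserves the order: once g has order at least m, the coefficient of
    tau^m in f * g is f(0) times that of g. *)
Lemma ordge_unitM m f g : fcoef f 0 != 0 -> ordge m (f * g) -> ordge m g.
Proof.
move=> f0_neq0 fg_m; elim: m fg_m => // m IHm fg_m i.
have g_m : ordge m g by apply: IHm; apply: ordgeW fg_m.
rewrite ltnS leq_eqVlt => /predU1P[->|/g_m//].
have := @fcoefM_low _ 0 m f g (@ordge0 _ _) g_m.
rewrite add0n fg_m // => /esym/eqP.
by rewrite mulf_eq0 (negbTE f0_neq0) => /eqP.
Qed.

(** The roots are split off one at a time. A further root z stays a root of the quotient, because
    the product of the nonzero differences z - y can be cancelled; counting degrees then leaves a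
    constant quotient. *)
Lemma fps_uniq_roots_prod P (s : seq (fps K)) :
    uniq s -> all (root P) s -> size P = (size s).+1 ->
  P = lead_coef P *: \prod_(z <- s) ('X - z%:P).
Proof.
move=> uniq_s root_s sizeP.
have [Q defP] : exists Q, P = Q * \prod_(z <- s) ('X - z%:P).
  elim: s uniq_s root_s {sizeP} => [|z s IHs] /=.
    by exists P; rewrite big_nil mulr1.
  case/andP=> z_notin_s uniq_s /andP[Pz0 root_s].
  have [Q defP] := IHs uniq_s root_s.
  suff /factor_theorem[Q' defQ] : root Q z.
    by exists Q'; rewrite big_cons mulrA -defQ.
  apply/eqP; apply: (@fps_mulf_eq0 (\prod_(y <- s) (z - y))); last first.
    move/eqP: Pz0; rewrite defP hornerM horner_prod mulrC => <-.
    by congr (_ * _); apply: eq_bigr => y _; rewrite !hornerE.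
  elim: {IHs uniq_s root_s defP} s z_notin_s => [|y s IHs].
    by rewrite big_nil oner_eq0.
  rewrite inE negb_or big_cons -subr_eq0 => /andP[zy_neq0 /IHs s_neq0].
  by apply/eqP => /(fps_mulf_eq0 zy_neq0) /eqP; apply/negP.
have mon : \prod_(z <- s) ('X - z%:P) \is monic := monic_prod_XsubC _ _ _.
have Q_neq0 : Q != 0.
  by apply: contra_eq_neq sizeP => Q0; rewrite defP Q0 mul0r size_poly0.
have sizeQ : (size Q <= 1)%N.
  move: sizeP; rewrite {1}defP size_Mmonic // size_prod_XsubC addnS /=.
  by rewrite -add1n => /addIn ->.
by rewrite {2}defP lead_coef_Mmonic // {1}defP {1}(size1_polyC sizeQ)
  mul_polyC lead_coefE; case: (size Q) sizeQ => [|[]].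
Qed.

Section Hensel.
Variables (P : {poly fps K}) (a : K).
Let P0 := map_poly (@fps_const K) P.
Hypothesis P0a : root P0 a.
Hypothesis P0a' : P0^`().[a] != 0.

(** Newton iteration with the derivative frozen at its residue P0'(a); stage m corrects only the
    coefficient of tau^m. *)
Fixpoint hensel_approx (m : nat) : fps K :=
  if m is l.+1 then
    let z := hensel_approx l in
    z + - (fpsXn K m * fpsC (fcoef P.[z] m / P0^`().[a]))
  else fpsC a.

Lemma hensel_approxS m :
  ordge m.+1 (hensel_approx m.+1 - hensel_approx m).
Proof.
rewrite [hensel_approx m.+1]/= addrAC subrr add0r.
by apply/ordgeN/ordgeMr/ordge_Xn.
Qed.

Lemma hensel_approx0 m : fps_const (hensel_approx m) = a.
Proof.
elim: m => // m IHm; apply/eqP; rewrite -subr_eq0 -[X in _ - X]IHm -rmorphB.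
by apply/eqP; apply: hensel_approxS.
Qed.

(** In the Taylor expansion at stage m, the quadratic term has order at least 2(m+1), which is at
    least m+2. The linear term cancels the coefficient of tau^(m+1), since P'(z) reduces to
    P0'(a). *)
Lemma horner_hensel_approx m : ordge m.+1 P.[hensel_approx m].
Proof.
elim: m => [[_|//]|m IHm].
  by rewrite -[LHS]/(fps_const P.[fpsC a]) fps_const_horner; apply/eqP.
set z := hensel_approx m in IHm; set w := fpsC (fcoef P.[z] m.+1 / P0^`().[a]).
rewrite /= -/z -/w.
have [k ->] := horner_taylor2 P z (- (fpsXn K m.+1 * w)).
have Xw : ordge m.+1 (- (fpsXn K m.+1 * w)) by apply/ordgeN/ordgeMr/ordge_Xn.
apply: ordgeD; last first.
  apply/ordgeMr/(@ordgeW _ (m.+1 + m.+1)); first by rewrite addnS ltnS leq_addr.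
  exact: ordgeM.
move=> i; rewrite ltnS leq_eqVlt => /predU1P[->|lt_i]; last first.
  by apply: ordgeD lt_i => //; apply: ordgeMl.
rewrite [LHS]/(_ + _).
have := @fcoefM_low _ 0 m.+1 P^`().[z] _ (@ordge0 _ _) Xw.
rewrite add0n [fcoef (- _) _]/(- _) fcoef_XnM leqnn subnn /=.
rewrite -[fcoef P^`().[z] 0]/(fps_const _) fps_const_horner.
rewrite hensel_approx0 -deriv_map -/P0 mulrN mulrCA divff // mulr1 => ->.
exact: subrr.
Qed.

Lemma hensel : exists2 z : fps K, fps_const z = a & root P z.
Proof.
(* Coefficient m no longer changes after stage m, so the diagonal is the limit. It agrees with stage
   m modulo tau^(m+1), and hence so do the values of P. *)
pose z := Fps (fun m => fcoef (hensel_approx m) m).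
exists z => //; apply/eqP/fpsP => m.
have z_m : ordge m.+1 (z - hensel_approx m).
  elim: m => [[_|//]|m IHm i]; first exact: subrr.
  rewrite ltnS leq_eqVlt => /predU1P[->|lt_i]; first exact: subrr.
  have -> : z - hensel_approx m.+1 =
    (z - hensel_approx m) - (hensel_approx m.+1 - hensel_approx m) by ring.
  by apply: ordgeB lt_i => //; apply: hensel_approxS.
have [k /eqP] := horner_subr P z (hensel_approx m); rewrite subr_eq => /eqP ->.
apply: (@ordgeD _ m.+1) => //; first exact: ordgeMr.
exact: horner_hensel_approx.
Qed.

End Hensel.
End FpsField.

(** * Families of the second kind over L: discriminant of the two t-roots with constant term 0 *)

Section SecondKind.
Variables (L : closedFieldType) (n : nat) (F : nat -> {poly L}).
Variables (A B C : {poly L}).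
Hypotheses (n_ge2 : (2 <= n)%N) (familyF : is_family n F).
Hypothesis kindF : second_kind n F A B C.
Hypothesis A0_neq0 : A.[0] != 0.
Let D := B.[0] ^+ 2 - A.[0] * C.[0].
Hypothesis D_neq0 : D != 0.
Hypothesis two_neq0 : 2%:R != 0 :> L.

Let F0E : F 0%N = 'X^2 * A. Proof. by case: kindF => _ []. Qed.
Let F1E : F 1%N = 2%:R *: ('X * B). Proof. by case: kindF => _ []. Qed.
Let F2E : F 2%N = C. Proof. by case: kindF => _ []. Qed.

Let F00 : (F 0%N)`_0 = 0. Proof. by rewrite F0E coefXnM. Qed.
Let F01 : (F 0%N)`_1 = 0. Proof. by rewrite F0E coefXnM. Qed.
Let F02 : (F 0%N)`_2 = A.[0].
Proof. by rewrite F0E coefXnM horner_coef0. Qed.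
Let F10 : (F 1%N)`_0 = 0. Proof. by rewrite F1E coefZ coefXM mulr0. Qed.
Let F11 : (F 1%N)`_1 = 2%:R * B.[0].
Proof. by rewrite F1E coefZ coefXM horner_coef0. Qed.
Let F20 : (F 2%N)`_0 = C.[0]. Proof. by rewrite F2E horner_coef0. Qed.

Let A_neq0 : A != 0.
Proof. by apply: contra_neq A0_neq0 => ->; rewrite horner0. Qed.

Lemma coef_ramified N i m : (i <= n)%N -> (0 < N)%N ->
  fcoef (ramified n F N)`_i m = if (N %| m)%N then (F (m %/ N)%N)`_i else 0.
Proof. by move=> le_in N_gt0; rewrite coef_poly ltnS le_in. Qed.

Lemma coef_ramified_mul N i m : (i <= n)%N -> (0 < N)%N ->
  fcoef (ramified n F N)`_i (m * N) = (F m)`_i.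
Proof. by move=> le_in N_gt0; rewrite coef_ramified // dvdn_mull // mulnK. Qed.

Lemma ordge_ramified N i m : (i <= n)%N -> (0 < N)%N ->
    (forall h, (h < m)%N -> (F h)`_i = 0) ->
  ordge (m * N) (ramified n F N)`_i.
Proof.
move=> le_in N_gt0 Fi0 h lt_h; rewrite coef_ramified //.
by case: ifP => // _; rewrite Fi0 // ltn_divLR.
Qed.

Lemma coef_mul_quad (R : comNzRingType) (Q : {poly R}) (a b : R) :
  let P := Q * (('X - a%:P) * ('X - b%:P)) in
  [/\ P`_0 = Q`_0 * (a * b), P`_1 = Q`_1 * (a * b) - Q`_0 * (a + b) &
      P`_2 = Q`_2 * (a * b) - Q`_1 * (a + b) + Q`_0].
Proof.
have -> : Q * (('X - a%:P) * ('X - b%:P)) =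
    (a * b) *: Q - (a + b) *: (Q * 'X) + Q * 'X * 'X.
  by rewrite -!mul_polyC polyCM polyCD; ring.
by split; rewrite !(coefD, coefN, coefZ, coefMX) /=; ring.
Qed.

Lemma lowcoef_quad N (Q : {poly fps L}) (a b : fps L) :
    (0 < N)%N -> ramified n F N = Q * (('X - a%:P) * ('X - b%:P)) ->
    fcoef a 0 = 0 -> fcoef b 0 = 0 ->
  lowcoef (Q`_0 ^+ 2 * (a - b) ^+ 2) = 4%:R * D.
Proof.
move=> N_gt0 defP a0 b0; set q0 := Q`_0; set q1 := Q`_1; set q2 := Q`_2.
have [] := coef_mul_quad Q a b; rewrite -defP -/q0 -/q1 -/q2.
set P := ramified n F N => P0 P1 P2.
have a_1 : ordge 1 a by case.
have b_1 : ordge 1 b by case.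
have P0_2 : ordge (2 * N) P`_0 by apply: ordge_ramified => // -[|[]].
have P1_1 : ordge (1 * N) P`_1.
  by apply: ordge_ramified => //; [apply: ltnW | case].
have ab_1 : ordge 1 (a * b) by apply: ordgeMr.
(* Since ab and a + b vanish at tau = 0, the constant terms of q0 and of the coefficient of x^2 in P
   agree, so q0 is a unit. *)
have q0_0 : fcoef q0 0 != 0.
  suff -> : fcoef q0 0 = A.[0] by [].
  rewrite -F02 -(@coef_ramified_mul N 2 0) // mul0n -/P P2 fcoefD.
  have /(_ 0%N isT) : ordge 1 (q2 * (a * b) - q1 * (a + b)).
    by apply: ordgeB; apply: ordgeMl => //; apply: ordgeD.
  by move=> ->; rewrite add0r.
have ab_2 : ordge (2 * N) (a * b) by apply: (ordge_unitM q0_0); rewrite -P0.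
have sum_1 : ordge (1 * N) (a + b).
  apply: (ordge_unitM q0_0).
  have -> : q0 * (a + b) = q1 * (a * b) - P`_1 by rewrite P1; ring.
  by apply: ordgeB => //; apply/ordgeMl/(ordgeW _ ab_2); rewrite leq_mul2r orbT.
(* The difference between P_1^2 - 4 P_0 P_2 and q0^2 (a - b)^2. Each of its terms contains ab, of
   order at least 2N, times a further factor ab or a + b, of order at least 1. *)
pose rest := 2%:R * q0 * q1 * ((a * b) * (a + b))
   + (q1 ^+ 2 - 4%:R * q0 * q2) * ((a * b) * (a * b)).
have rest_gt : ordge (2 * N).+1 rest.
  apply: ordgeD; apply: ordgeMl; rewrite -addn1; apply: ordgeM => //.
  by apply: ordgeD.
have eq_disc : q0 ^+ 2 * (a - b) ^+ 2 = P`_1 ^+ 2 - 4%:R * (P`_0 * P`_2) - rest.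
  by rewrite P0 P1 P2 /rest; ring.
have two1N : (2 * N = 1 * N + 1 * N)%N by rewrite -mulnDl.
have P1sq : ordge (2 * N) (P`_1 ^+ 2) by rewrite two1N; apply: ordgeM.
have P02 : ordge (2 * N) (P`_0 * P`_2) by apply: ordgeMr.
have four (f : fps L) i : fcoef (4%:R * f) i = 4%:R * fcoef f i.
  by rewrite !mulr_natl; rewrite !mulrS /= !addr0.
have disc_2 : ordge (2 * N) (q0 ^+ 2 * (a - b) ^+ 2).
  rewrite eq_disc; apply: ordgeB; last exact: ordgeW rest_gt.
  by apply: ordgeB => //; apply: ordgeMl.
have disc_coef : fcoef (q0 ^+ 2 * (a - b) ^+ 2) (2 * N) = 4%:R * D.
  rewrite eq_disc !fcoefB four rest_gt // subr0.
  have -> : fcoef (P`_1 ^+ 2) (2 * N) = (2%:R * B.[0]) ^+ 2.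
    rewrite {1}two1N expr2 fcoefM_low //.
    by rewrite coef_ramified_mul ?(ltnW n_ge2) // F11.
  have := @fcoefM_low _ _ 0 _ P`_2 P0_2 (@ordge0 _ _).
  rewrite addn0 => ->.
  rewrite coef_ramified_mul // F20 -[X in fcoef P`_2 X](mul0n N).
  by rewrite coef_ramified_mul // F02 /D; ring.
(* The coefficient of tau^(2N) is the lowest one only because 4 D is nonzero. *)
rewrite (lowcoefE disc_2) disc_coef // mulf_neq0 // (_ : 4%:R = 2%:R * 2%:R).
  by rewrite mulf_neq0.
by rewrite -natrM.
Qed.

(** * Every admissible choice of t-roots gives the stated value *)

Lemma roots_X : Defs.roots ('X : {poly L}) = [:: 0].
Proof.
rewrite /Defs.roots; case: closed_field_poly_normal => r /=.
rewrite lead_coefX scale1r => defX.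
have := congr1 (fun p : {poly L} => size p) defX.
rewrite size_polyX size_prod_XsubC => -[].
case: r defX => [|a []] //; rewrite big_seq1 => /(congr1 (fun p => p.[0])).
by rewrite !hornerE => /esym/eqP; rewrite oppr_eq0 => /eqP ->.
Qed.

Lemma lowcoef1 : lowcoef (1 : fps L) = 1.
Proof. by rewrite (@lowcoefE _ 0) // oner_eq0. Qed.

Definition second_kind_fs : 2.-tuple ({poly L} * nat) :=
  [tuple ('X, 2%N); (A, 1%N)].

Lemma is_factorization_second_kind : is_factorization F second_kind_fs.
Proof.
have copXA : coprimep 'X A.
  by rewrite coprimep_sym coprimepX.
split; first by rewrite big_ord_recl big_ord1 /= expr1.
  by case=> -[|[|]].
by case=> -[|[|//]] i /= [] [|[|//]] h //= _; rewrite coprimep_sym.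
Qed.

Lemma Delta1 (Q : {poly fps L}) s : Delta Q 1 s = 1.
Proof. by rewrite /Delta muln1 subnn mul1r big_ord1 big_mkcond big_ord1. Qed.

Lemma Delta2 (Q p q : {poly fps L}) :
  Delta Q 2 [:: p; q] = Q ^+ 2 * (p - q) ^+ 2.
Proof.
rewrite /Delta big_ord_recl big_ord1 !(big_mkcond (fun _ => _ < _)%N).
by rewrite !big_ord_recl !big_ord0 /= !mul1r !mulr1.
Qed.

(** For f = x the bound deg < 1 makes both s'_i constant in x, and they vanish at tau = 0;
    [lowcoef_quad] then applies with Q = [Qpart]. *)
Lemma f_roots_X_val N s s' : (0 < N)%N -> f_roots n F N s 'X 2 s' ->
  lowcoef (Delta (Qpart n F N s 'X 2) 2 s').[fpsC 0] = 4%:R * D.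
Proof.
move=> N_gt0 [/eqP]; case: s' => [|a [|b []]] // _ small_s' defP.
have constP r : r \in [:: a; b] -> r = (r`_0)%:P /\ fcoef r`_0 0 = 0.
  by move=> /small_s'[]; rewrite size_polyX ltnS => /size1_polyC.
have [def_a a0] := constP a (mem_head _ _).
have [def_b b0] : b = (b`_0)%:P /\ fcoef b`_0 0 = 0.
  by apply: constP; rewrite !inE eqxx orbT.
move: defP; rewrite big_cons big_seq1 map_polyX def_a def_b.
set Q := Qpart _ _ _ _ _ _ => defP; rewrite -(lowcoef_quad N_gt0 defP a0 b0).
rewrite Delta2 rmorph0 hornerM !horner_exp hornerD hornerN !hornerC.
by rewrite horner_coef0.
Qed.

Lemma is_Ver_second_kind_val y :
  is_Ver n F second_kind_fs y -> y = 4%:R * D * A.[0] ^+ 2.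
Proof.
case=> _ [N [s [s' [[N_gt0 _ _] f_s' ->]]]].
have := f_s' ord0; rewrite (tnth_nth ('X, 0%N)) /=.
move=> /(f_roots_X_val N_gt0) val.
rewrite !big_ord_recl !big_ord0 !big_mkcond !big_ord_recl !big_ord0 /=.
rewrite roots_X big_seq1 val big1 => [|a _]; last first.
  by rewrite Delta1 hornerC lowcoef1.
rewrite big_pred0 ?mulr1 ?mul1r; last by case=> -[|[|]].
(* The resultant exponent 2 (2 + 1 - 2) evaluates to 2, and Res(x, A) = A(0). *)
by rewrite /Res lead_coefX expr1n mul1r roots_X big_seq1.
Qed.

(** * Existence of an admissible choice, with N = 1 *)

Let P := ramified n F 1.

Lemma coef_ramified1 i m : (i <= n)%N -> fcoef P`_i m = (F m)`_i.
Proof. by move=> le_in; rewrite -[m in LHS]muln1 coef_ramified_mul. Qed.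

Lemma map_ramified1 : map_poly (@fps_const L) P = F 0%N.
Proof.
apply/polyP => i; rewrite coef_map /=.
have [le_in|lt_ni] := leqP i n; first exact: coef_ramified1.
rewrite !nth_default ?rmorph0 //; first by case: familyF => ->.
by apply: leq_trans (size_poly _ _) _.
Qed.

Lemma lead_coef_F0 : lead_coef (F 0%N) = lead_coef A.
Proof. by rewrite F0E mulrC lead_coef_Mmonic ?monicXn. Qed.

Lemma F0n : (F 0%N)`_n = lead_coef A.
Proof. by rewrite -lead_coef_F0 lead_coefE; case: familyF => ->. Qed.

Lemma ramified1_n_neq0 : P`_n != 0.
Proof.
have : lead_coef A != 0 by rewrite lead_coef_eq0.
by apply: contra_neq => Pn0; rewrite -F0n -coef_ramified1 // Pn0.
Qed.

Lemma size_ramified1 : size P = n.+1.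
Proof.
by apply: size_poly_eq; move: ramified1_n_neq0; rewrite coef_poly ltnSn.
Qed.

Hypothesis sepA : separable_poly A.

(** The derivative of x^2 A at a root a of A is a^2 A'(a). It is nonzero by A(0) != 0 and
    separability, so Hensel's lemma applies. *)
Lemma simple_t_root a : root A a ->
  exists2 z : fps L, fps_const z = a & root P z.
Proof.
move=> Aa; have a_neq0 : a != 0.
  by apply: contra_neq A0_neq0 => a0; move: Aa; rewrite a0 => /eqP.
apply: hensel; rewrite map_ramified1 F0E.
  by rewrite rootM Aa orbT.
rewrite derivM derivXn !hornerE (eqP Aa) mulr0 add0r mulf_neq0 //.
  by rewrite mulf_neq0.
by apply: coprimep_root Aa; move: sepA; rewrite unlock.
Qed.

Lemma simple_t_roots : exists2 zs : seq (fps L),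
  map (@fps_const L) zs = Defs.roots A & all (root P) zs.
Proof.
have : all (root A) (Defs.roots A).
  apply/allP => a a_in; rewrite /Defs.roots in a_in.
  case: closed_field_poly_normal a_in => r /= -> a_in.
  by rewrite rootZ ?lead_coef_eq0 // root_prod_XsubC.
elim: (Defs.roots A) => [|a r IHr] /=; first by exists [::].
case/andP=> /simple_t_root[z za Pz] /IHr[zs zsr Pzs].
by exists (z :: zs) => /=; rewrite ?za ?zsr ?Pz.
Qed.

(* F(t w, t) = t^2 G(w, t), where G(w, 0) = A(0) w^2 + 2 B(0) w + C(0) has
   discriminant 4 D. *)
Let G : {poly fps L} := \poly_(i < n.+1)
  Fps (fun m => if (i <= m + 2)%N then (F (m + 2 - i)%N)`_i else 0).

Lemma horner_G w : P.[fpsXn L 1 * w] = fpsXn L 2 * G.[w].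
Proof.
rewrite !horner_poly mulr_sumr; apply: eq_bigr => i _.
rewrite exprMn fpsXnX mulrA [RHS]mulrA; congr (_ * _).
apply: fpsP => m; rewrite [in LHS]mulrC !fcoef_XnM /= dvd1n divn1.
have [le_2m|] := leqP 2 m; first by rewrite subnK.
(* Below t^2 nothing survives on the left: x^2 divides F_0 and x divides F_1. *)
case: m => [|[|//]] _; first by case: ifP => //; rewrite leqn0 => /eqP->.
by case: (i : nat) => [|[|]].
Qed.

Lemma map_G :
  map_poly (@fps_const L) G = A.[0] *: 'X^2 + (2%:R * B.[0]) *: 'X + (C.[0])%:P.
Proof.
apply/polyP => i; rewrite coef_map coef_poly !coefD !coefZ coefXn coefX coefC.
case: i => [|[|[|i]]] /=.
- by rewrite !mulr0 !add0r -F20.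
- by rewrite ltnS ltnW // -F11 mulr0 mulr1 addr0 add0r.
- by rewrite ltnS n_ge2 -F02 mulr0 mulr1 !addr0.
by rewrite !mulr0 !addr0; case: ifP => // _; rewrite rmorph0.
Qed.

(** The quadratic G(w, 0) has the root (e - B(0)) / A(0), where its derivative is 2e, nonzero since
    e^2 = D. The root w lifts, and z = t w; its coefficient of t is recorded to tell the roots for e
    and -e apart. *)
Lemma double_t_root e : e ^+ 2 = D ->
  exists z : fps L,
    [/\ root P z, fps_const z = 0 & fcoef z 1 = (e - B.[0]) / A.[0]].
Proof.
move=> e2; set a := (e - B.[0]) / A.[0].
have [||w wa Gw] := @hensel _ G a.
- apply/eqP; rewrite map_G !hornerD !hornerZ hornerXn hornerX hornerC.
  apply: (mulfI A0_neq0).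
  transitivity (e ^+ 2 - D); last by rewrite e2 subrr mulr0.
  by rewrite /a /D; field.
- have -> : (map_poly (@fps_const L) G)^`().[a] = 2%:R * e.
    rewrite map_G !derivD !derivZ derivXn derivX derivC addr0 /=.
    by rewrite expr1 !hornerD !hornerZ hornerMn hornerX hornerC /a; field.
  rewrite mulf_neq0 //; apply: contra_neq D_neq0 => e0.
  by rewrite -e2 e0 expr0n.
exists (fpsXn L 1 * w); split; first by rewrite /root horner_G (eqP Gw) mulr0.
  exact: fps_const_XnM.
by rewrite fcoef_XnM.
Qed.

Lemma t_roots_second_kind : exists (z1 z2 : fps L) (zs : seq (fps L)),
  [/\ t_roots n F 1 [:: z1, z2 & zs], fps_const z1 = 0, fps_const z2 = 0 &
      map (@fps_const L) zs = Defs.roots A].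
Proof.
have [zs zsA Pzs] := simple_t_roots.
have [e e2] : exists e, e ^+ 2 = D.
  (* The coefficient function encodes the equation e^2 = D + 0 e. *)
  have [e] := @solve_monicpoly L 2 (fun i => if i == 0%N then D else 0) isT.
  by rewrite !big_ord_recl big_ord0 /= mulr1 mul0r !addr0 => e2; exists e.
have [z1 [Pz1 z1_0 z1_1]] := double_t_root e2.
have [z2 [Pz2 z2_0 z2_1]] : exists z : fps L,
    [/\ root P z, fps_const z = 0 & fcoef z 1 = (- e - B.[0]) / A.[0]].
  by apply: double_t_root; rewrite sqrrN.
have A_roots : A = lead_coef A *: \prod_(a <- Defs.roots A) ('X - a%:P).
  by rewrite /Defs.roots; case: closed_field_poly_normal.
have uniqA : uniq (Defs.roots A).
  rewrite -separable_prod_XsubC.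
  rewrite -(@eqp_separable _ A) // [X in X %= _]A_roots eqp_scale //.
  by rewrite lead_coef_eq0.
have zs_neq0 z : fps_const z = 0 -> z \notin zs.
  move=> z0; apply: contra A0_neq0 => /(map_f (@fps_const L)).
  rewrite zsA z0 => A0; rewrite -/(root A 0) A_roots.
  by rewrite rootZ ?lead_coef_eq0 // root_prod_XsubC.
(* Equal coefficients of t would give e = -e, hence e = 0 and D = 0. *)
have z12 : z1 != z2.
  apply: contra_neq D_neq0 => z12; rewrite -e2; move: z1_1.
  rewrite z12 z2_1 => /(mulIf (invr_neq0 A0_neq0))/addIr/eqP.
  rewrite eq_sym -addr_eq0 -mulr2n -mulr_natl mulf_eq0 (negbTE two_neq0) /=.
  by move=> /eqP->; rewrite expr0n.
exists z1, z2, zs; split => //.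
have size_zs : size [:: z1, z2 & zs] = n.
  have sizeA : size A = (size zs).+1.
    rewrite A_roots size_scale ?lead_coef_eq0 // size_prod_XsubC.
    by rewrite -zsA size_map.
  case: familyF => sizeF _; move: sizeF.
  by rewrite F0E mulrC size_mulXn // sizeA => -[].
split=> //; apply: fps_uniq_roots_prod; last by rewrite size_zs size_ramified1.
- rewrite /= inE negb_or z12 !zs_neq0 //=.
  by apply: (@map_uniq _ _ (@fps_const L)); rewrite zsA.
by rewrite /= Pz1 Pz2.
Qed.

Lemma ex_Ver_second_kind : exists y, is_Ver n F second_kind_fs y.
Proof.
have [z1 [z2 [zs [troots z1_0 z2_0 zsA]]]] := t_roots_second_kind.
set s := [:: z1, z2 & zs] in troots; case: (troots) => _ _ defP.
have A_roots : A = lead_coef A *: \prod_(a <- Defs.roots A) ('X - a%:P).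
  by rewrite /Defs.roots; case: closed_field_poly_normal.
have root_zs z : z \in zs -> root A (fps_const z).
  move=> /(map_f (@fps_const L)); rewrite zsA => z_in.
  by rewrite A_roots rootZ ?lead_coef_eq0 // root_prod_XsubC.
pose w := (fpsC (lead_coef A)) *: \prod_(z <- zs) ('X - z%:P).
(* With n_2 = 1 the single s' must be A - w, where w collects the t-roots lifting those of A. As w
   has the same reduction at t = 0 and the same leading coefficient as A, r vanishes at t = 0 and
   has smaller degree. *)
pose r := map_poly (@fpsC L) A - w.
have const_r : map_poly (@fps_const L) r = 0.
  rewrite rmorphB /= -map_poly_comp map_poly_id // /w map_polyZ rmorph_prod /=.
  rewrite [X in X - _]A_roots -zsA big_map; apply/eqP; rewrite subr_eq0.
  apply/eqP; congr (_ *: _); apply: eq_bigr => z _.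
  by rewrite rmorphB /= map_polyX map_polyC.
have size_A : size A = (size zs).+1.
  by rewrite A_roots size_scale ?lead_coef_eq0 // size_prod_XsubC -zsA size_map.
have size_r : (size r < size A)%N.
  rewrite size_A ltnS; apply/leq_sizeP => i le_i.
  rewrite coefB coef_map coefZ /=; move: le_i.
  rewrite leq_eqVlt => /predU1P[<-|lt_i]; last first.
    by rewrite !nth_default ?size_prod_XsubC ?size_A // rmorph0 mulr0 subr0.
  have := monic_prod_XsubC zs xpredT id.
  rewrite monicE lead_coefE size_prod_XsubC /= => /eqP->.
  by rewrite lead_coefE size_A mulr1 subrr.
pose s' (v : 'I_2) := if v == ord0 then [:: z1%:P; z2%:P] else [:: r].
eexists; split; first exact: is_factorization_second_kind.
exists 1%N, s, s'; split=> // -[[|[|//]] lt_v].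
- rewrite (tnth_nth ('X, 0%N)) /s' /=; split=> //.
    move=> q; rewrite !inE size_polyX ltnS => /orP[] /eqP->;
    by rewrite size_polyC_leq1; split=> // -[|j]; rewrite coefC.
  rewrite /Qpart lead_coefX expr1n invr1 rmorph1 mul1r map_polyX [LHS]defP.
  rewrite !big_cons !big_nil mulr1 !hornerX.
  rewrite -[fcoef z1 0]/(fps_const z1) -[fcoef z2 0]/(fps_const z2).
  rewrite z1_0 z2_0 eqxx /=.
  (* The constant terms of [zs] are roots of A, hence nonzero, so the filter keeps all of [zs]. *)
  have -> : \prod_(z <- zs | 'X.[fcoef z 0] != 0) ('X - z%:P) =
      \prod_(z <- zs) ('X - z%:P).
    rewrite big_seq_cond [RHS]big_seq; apply: eq_bigl => z.
    case: (boolP (z \in zs)) => //= /root_zs Az; rewrite hornerX.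
    apply/eqP => z0; case/eqP: A0_neq0.
    by move: Az; rewrite /fps_const z0 => /eqP.
  by rewrite -scalerAl mulrA mulrC.
rewrite (tnth_nth ('X, 0%N)) /s' /=; split=> //.
  move=> q; rewrite inE => /eqP->; split=> // j.
  by rewrite -[LHS]/(fps_const r`_j) -coef_map const_r coef0.
rewrite big_seq1 /r opprB addrCA subrr addr0 /w /Qpart expr1 !big_cons.
rewrite -[fcoef z1 0]/(fps_const z1) -[fcoef z2 0]/(fps_const z2).
rewrite z1_0 z2_0 A0_neq0 big_seq_cond big_pred0 ?mulr1; last first.
  move=> z; case: (boolP (z \in zs)) => //= /root_zs /eqP.
  by rewrite /fps_const => ->; rewrite eqxx.
(* The factor [lead_coef A ^- 1] in [Qpart] cancels the leading coefficient put into w. *)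
rewrite -scalerAl -scalerAr scalerA mulrAC -rmorphM mulVf ?lead_coef_eq0 //.
by rewrite rmorph1 mul1r [LHS]defP !big_cons mulrA.
Qed.

(** Conversely, some value is attained, and any attained value is the stated one. *)
Lemma is_Ver_second_kindP y :
  is_Ver n F second_kind_fs y <-> y = 4%:R * D * A.[0] ^+ 2.
Proof.
split=> [|->]; first exact: is_Ver_second_kind_val.
by have [z Vz] := ex_Ver_second_kind; rewrite -(is_Ver_second_kind_val Vz).
Qed.

End SecondKind.

(** * Square-free against separable in characteristic zero, and transport from A to L *)

Lemma deriv_neq0_pchar0 (K : fieldType) (p : {poly K}) :
  [pchar K] =i pred0 -> (1 < size p)%N -> p^`() != 0.
Proof.
move=> /pcharf0P char0 size_p.
have p_neq0 : p != 0 by rewrite -size_poly_gt0 ltnW.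
apply: contraTneq p_neq0 => p'0; rewrite -lead_coef_eq0 lead_coefE.
case: (size p) size_p => [|[|m]] // _.
have /eqP := congr1 (fun q : {poly K} => q`_m) p'0.
rewrite coef_deriv coef0 -mulr_natl mulf_eq0 char0 /=.
by move=> /eqP->; rewrite eqxx.
Qed.

Lemma square_free_separable (K : fieldType) (p : {poly K}) :
  [pchar K] =i pred0 -> p != 0 -> square_free p -> separable_poly p.
Proof.
move=> char0 p_neq0 sqfree_p; apply/separable_polyP; split=> [|u _]; last first.
  exact: deriv_neq0_pchar0.
apply/poly_square_freeP => u size_u; have [u_gt1|] := ltnP 1 (size u).
  exact: sqfree_p.
(* The remaining case is u = 0, whose square does not divide the nonzero p. *)
rewrite leq_eqVlt (negbTE size_u) ltnS leqn0 size_poly_eq0 => /eqP->.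
by rewrite expr0n dvd0p.
Qed.

Theorem proposition3p3
  (k : closedFieldType) (char_k : [pchar k] =i pred0)
  (A : idomainType) (iota : {rmorphism k -> A})
  (L : closedFieldType) (j : {rmorphism {fraction A} -> L})
  (algL : forall z : L, algebraicOver j z)
  (n : nat) (n_ge2 : (2 <= n)%N) (F : nat -> {poly A})
  (An2 Bn1 Cn : {poly A})
  (familyF : is_family n F)
  (kindF : second_kind n F An2 Bn1 Cn)
  (nondeg : An2.[0] * (Bn1.[0] ^+ 2 - An2.[0] * Cn.[0]) != 0)
  (sqfreeA : square_free (map_poly (@tofrac A) An2)) :
  let toL (a : A) : L := j (tofrac a) in
  forall y : L,
    is_Ver n (fun i => map_poly toL (F i))
      [tuple ('X, 2%N); (map_poly toL An2, 1%N)] y <->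
    y = toL (4%:R * (Bn1.[0] ^+ 2 - An2.[0] * Cn.[0]) * An2.[0] ^+ 2).
Proof.
move=> toL y; pose g : {rmorphism A -> L} := j \o @tofrac A.
rewrite -/(second_kind_fs (map_poly g An2)).
have g_eq0 a : (g a == 0) = (a == 0) by rewrite /= fmorph_eq0 tofrac_eq0.
have g_inj : injective g.
  by move=> a b /eqP; rewrite -subr_eq0 -rmorphB g_eq0 subr_eq0 => /eqP.
have size_g p : size (map_poly g p) = size p.
  by rewrite size_map_inj_poly ?rmorph0.
have horner_g p : (map_poly g p).[0] = g p.[0].
  by rewrite -[X in _.[X] = _](rmorph0 g) horner_map.
(* Characteristic zero passes from k to Frac(A) through [iota], and then to L. *)
have char_frac : [pchar {fraction A}] =i pred0.
  by move=> p; rewrite (fmorph_pchar (@tofrac A \o iota)) char_k.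
have two_neq0 : 2%:R != 0 :> L.
  rewrite -(rmorph_nat j) fmorph_eq0.
  by have /pcharf0P-> := char_frac.
move: nondeg; rewrite mulf_eq0 negb_or => /andP[A0_neq0 D_neq0].
have A_neq0 : An2 != 0 by apply: contraNneq A0_neq0 => ->; rewrite horner0.
(* Square-freeness is given over Frac(A). It is turned there into separability, which is invariant
   under the field extension to L. *)
have sepA : separable_poly (map_poly g An2).
  rewrite [map_poly g An2]map_poly_comp separable_map.
  apply: square_free_separable => //.
  rewrite -size_poly_eq0 size_map_inj_poly ?size_poly_eq0 ?rmorph0 // => a b.
  by move/eqP; rewrite tofrac_eq => /eqP.
have familyG : is_family n (fun i => map_poly g (F i)).
  by case: familyF => sizeF0 sizeF; split=> [|i]; rewrite size_g.
have kindG : second_kind n (fun i => map_poly g (F i))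
    (map_poly g An2) (map_poly g Bn1) (map_poly g Cn).
  case: kindF => -[sizeA sizeB sizeC] [F0 F1 F2].
  split; split; rewrite ?size_g //.
  - by rewrite F0 rmorphM /= map_polyXn.
  - by rewrite F1 map_polyZ rmorphM [g _]rmorph_nat /= map_polyX.
  - by rewrite F2.
have -> : toL (4%:R * (Bn1.[0] ^+ 2 - An2.[0] * Cn.[0]) * An2.[0] ^+ 2) =
    4%:R * ((map_poly g Bn1).[0] ^+ 2 -
      (map_poly g An2).[0] * (map_poly g Cn).[0]) * (map_poly g An2).[0] ^+ 2.
  rewrite -[toL _]/(g _) !horner_g.
  by rewrite !(rmorphM g, rmorphB g, rmorphXn g, rmorph_nat g).
apply: is_Ver_second_kindP => //; first by rewrite horner_g g_eq0.
by rewrite !horner_g -rmorphXn -rmorphM -rmorphB g_eq0.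
Qed.
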